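(* Let $V$ be an oriented $n$-dimensional Euclidean vector space with volume form $\nu$ and let $T$ belong to $Cl_n(V)$. Then: (i) if $n\equiv 0$ (mod 4) and $T\in Cl_n^0\cap Cl_n^{+}$ is unipotent, that is $T^t=T$ and $T^2=1+\nu$, then the holonomy algebra $\mathfrak h_T^{\star}$ is isomorphic to $\mathfrak{so}(n,1)$ and $\mathfrak g_T^{\star}$ is perfect; (ii) if $n\equiv 7$ (mod 8) and $T=x\otimes x$ is the square of a unit spinor $x\in S$, then $\mathfrak g_T^{\star}$ is abelian; in particular the holonomy algebra $\mathfrak h_T^{\star}$ vanishes; (iii) if $n\equiv 0$ (mod 8) and $T=x\otimes x$ is the square of a positive unit spinor $x\in S^{+}$, then the fix algebra $\mathfrak g_T^{\star}$ is perfect and the holonomy algebra $\mathfrak h_T^{\star}$ is isomorphic to $\mathfrak{so}(n,1)$.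
   Context: $Cl_n=Cl_n(V)$ is the real Clifford algebra of $(V,\langle\cdot,\cdot\rangle)$ with convention $v\cdot v=-|v|^2$; it is identified as a vector space with $\Lambda^*(V)$ via the canonical isomorphism, under which $e\cdot\varphi=e\wedge\varphi-e\lrcorner\varphi$ and $\varphi\cdot e=(-1)^k(e\wedge\varphi+e\lrcorner\varphi)$ for $e\in V\cong\Lambda^1(V)$, $\varphi\in\Lambda^k(V)$. Interior multiplication $X\lrcorner$ acts on $Cl_n$ (linearly, degree by degree) through this identification. $(\cdot)^t$ is the anti-automorphism of $Cl_n$ with $(e_1\cdots e_k)^t=e_k\cdots e_1$ on products of vectors. $Cl_n^0$ is the span of even-degree forms. $\nu=e_1\cdots e_n$ (oriented orthonormal frame) is the volume element; for $n\equiv 0,3$ (mod 4), $\nu^2=1$ and $Cl_n^{\pm}=\{\varphi:\nu\varphi=\pm\varphi\}$. $Cl_n$ is a Lie algebra under the commutator; the fix algebra $\mathfrak g_T^{\star}$ is the Lie subalgebra generated by $\{X\lrcorner T:X\in V\}$, and the holonomy algebra is $\mathfrak h_T^{\star}=[\mathfrak g_T^{\star},\mathfrak g_T^{\star}]$. A Lie algebra $\mathfrak g$ is perfect if $[\mathfrak g,\mathfrak g]=\mathfrak g$. $S$ is an irreducible real $Cl_n$-module with its usual scalar product (unit vectors act orthogonally); for $n\equiv 0$ (mod 4), $S=S^+\oplus S^-$ with $\nu=\pm1$ on $S^{\pm}$; for $n\equiv 3$ (mod 4) one takes the module on which $\nu$ acts as $+1$. For $n\equiv 0$ (mod 8) Clifford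 multiplication is an isomorphism $Cl_n\to \mathrm{End}_{\mathbb R}(S)$, and for $n\equiv 7$ (mod 8) it restricts to an isomorphism $Cl_n^+\to\mathrm{End}_{\mathbb R}(S)$. The square $x\otimes x$ of a unit spinor $x$ (with $x\in S^+$ if $n\equiv 0$ mod 8, $x\in S$ if $n\equiv 7$ mod 8) is the element of $Cl_n$ (resp. $Cl_n^+$) determined by $(x\otimes x)\psi=\langle\psi,x\rangle x$ for all $\psi\in S$. *)

(* Defs.v *)
From HB Require Import structures.
From mathcomp Require Import all_boot all_order all_algebra all_field.
From mathcomp Require Import reals.

Set Implicit Arguments.
Unset Strict Implicit.
Unset Printing Implicit Defensive.

Import Order.TTheory GRing.Theory Num.Theory.
Local Open Scope ring_scope.

(* An associative algebra A is regarded as a Lie algebra under the commutator,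
   and finite-dimensional Lie subalgebras of A are given as subspaces of A. *)
Section LieSubalgebras.
Variables (K : fieldType) (A : falgType K).
Implicit Types (a b : A) (U W X : {vspace A}).

Definition lie_bracket a b : A := a * b - b * a.

(* [U, W], the span of all brackets [u, w]; see commvP. *)
Definition commv U W : {vspace A} :=
  <<allpairs lie_bracket (vbasis U) (vbasis W)>>%VS.

Definition lie_closed U := {in U &, forall a b, lie_bracket a b \in U}.

(* The Lie subalgebra generated by U: the ascending chain U_0 = U,
   U_(k+1) = U_k + [U_k, U_k] is stationary from k = dim A on.
   The lemmas sub_lie_gen, lie_gen_closed and lie_gen_min say that the result
   is the smallest Lie subalgebra containing U. *)
Definition lie_step U : {vspace A} := (U + commv U U)%VS.
Definition lie_gen U : {vspace A} := iter (\dim {:A}) lie_step U.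

Definition lie_perfect U := commv U U = U.

Definition lie_abelian U := {in U &, forall a b, lie_bracket a b = 0}.

Lemma memv_comm U W : {in U & W, forall a b, lie_bracket a b \in commv U W}.
Proof.
move=> u w /coord_vbasis-> /coord_vbasis->.
rewrite /lie_bracket mulr_suml mulr_sumr -sumrB.
apply: memv_suml => i _; rewrite mulr_sumr mulr_suml -sumrB.
apply: memv_suml => j _.
rewrite -!scalerAl -!scalerAr !scalerA [X in _ - X *: _]mulrC -scalerBr.
rewrite memvZ // memv_span //.
by apply/allpairsP; exists ((vbasis U)`_i, (vbasis W)`_j); rewrite !memt_nth.
Qed.

Lemma commvP U W X :
  reflect {in U & W, forall a b, lie_bracket a b \in X} (commv U W <= X)%VS.
Proof.
apply: (iffP idP) => [sX u w Uu Ww | sX].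
  by rewrite (subvP sX) ?memv_comm.
apply/span_subvP=> _ /allpairsP[[u w] /= [Uu Ww ->]].
by rewrite sX ?vbasis_mem.
Qed.

Lemma sub_lie_gen U : (U <= lie_gen U)%VS.
Proof.
rewrite /lie_gen; elim: (\dim {:A}) => //= m IH.
exact: subv_trans IH (addvSl _ _).
Qed.

Lemma lie_gen_min U W : (U <= W)%VS -> lie_closed W -> (lie_gen U <= W)%VS.
Proof.
move=> sUW cW; rewrite /lie_gen; elim: (\dim {:A}) => //= m IH.
rewrite subv_add IH; apply/commvP => a b Ua Ub.
by apply: cW; apply: (subvP IH).
Qed.

Lemma lie_gen_closed U : lie_closed (lie_gen U).
Proof.
suff fixg : lie_step (lie_gen U) = lie_gen U.
  by move=> a b ga gb; rewrite -fixg (subvP (addvSr _ _)) ?memv_comm.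
suff dichot m : lie_step (iter m lie_step U) = iter m lie_step U
    \/ (m < \dim (lie_step (iter m lie_step U)))%N.
  case: (dichot (\dim {:A})) => // /leq_trans/(_ (dimvS (subvf _))).
  by rewrite ltnn.
have step_dim W : lie_step W = W \/ (\dim W < \dim (lie_step W))%N.
  case: (eqVneq W (lie_step W)) => [<-|neq]; [by left | right].
  rewrite ltn_neqAle dimvS ?addvSl // andbT; apply: contraNneq neq => eqd.
  by rewrite eqEdim addvSl eqd leqnn.
elim: m => [|m [IH|IH]] /=.
- by case: (step_dim U) => [|/(leq_ltn_trans (leq0n _))]; [left | right].
- by left; rewrite !IH.
- by case: (step_dim (lie_step (iter m lie_step U))) => [|lt];
    [left | right; apply: leq_ltn_trans lt].
Qed.

End LieSubalgebras.

(* A Lie algebra isomorphism g -> h is the restriction to g of some linear map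
   f : A -> B between the ambient spaces. *)
Definition lie_isom (K : fieldType) (A B : falgType K)
    (g : {vspace A}) (h : {vspace B}) : Prop :=
  exists f : 'Hom(A, B),
    [/\ {in g &, injective f}, (f @: g)%VS = h
      & {in g &, {morph f : a b / lie_bracket a b >-> lie_bracket a b}}].

Section LorentzAlgebra.
Variables (K : fieldType) (n : nat).

Definition lorentz_gram : 'M[K]_n.+1 :=
  diag_mx (\row_i (if i == ord_max then -1 else 1)).

Definition so_n1 : {vspace 'M[K]_n.+1} :=
  lker (linfun (fun A : 'M[K]_n.+1 =>
          A^T *m lorentz_gram + lorentz_gram *m A)).

Lemma mem_so_n1 (A : 'M[K]_n.+1) :
  (A \in so_n1) = (A^T *m lorentz_gram + lorentz_gram *m A == 0).
Proof.
have lin : linear (fun A : 'M[K]_n.+1 =>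
    A^T *m lorentz_gram + lorentz_gram *m A).
  move=> a B C; rewrite linearP /= mulmxDl mulmxDr -scalemxAl -scalemxAr.
  by rewrite scalerDr addrACA.
pose mixin := GRing.isSemilinear.Build _ _ _ _ _ (GRing.semilinear_linear lin).
pose F : {linear 'M[K]_n.+1 -> 'M[K]_n.+1} :=
  HB.pack (fun A : 'M[K]_n.+1 => A^T *m lorentz_gram + lorentz_gram *m A) mixin.
by rewrite memv_ker (lfunE F).
Qed.

End LorentzAlgebra.

Section CliffordAlgebra.
Variables (R : realType) (V : vectType R) (dot : {dot V for @idfun R}).

(* The universal property of the Clifford algebra of the quadratic form q,
   with i v * i v = q v. *)
Definition is_clifford_algebra (q : V -> R) (A : falgType R)
    (i : 'Hom(V, A)) : Prop :=
  (forall v, i v * i v = (q v)%:A) /\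
  (forall (B : algType R) (j : {linear V -> B}),
     (forall v, j v * j v = (q v)%:A) ->
     exists f : {lrmorphism A -> B},
       (forall v, f (i v) = j v) /\
       (forall f' : {lrmorphism A -> B}, (forall v, f' (i v) = j v) ->
          f' =1 f)).

Definition is_Cl (Cl : falgType R) (i : 'Hom(V, Cl)) : Prop :=
  is_clifford_algebra (fun v => - dot v v) i.

Definition is_exterior_algebra (L : falgType R) (j : 'Hom(V, L)) : Prop :=
  is_clifford_algebra (fun=> 0) j.

(* The product of L is the wedge product, so this is the span of the k-fold
   wedge products of vectors. *)
Definition ext_power (L : falgType R) (j : 'Hom(V, L)) (k : nat) :
  {vspace L} := (limg j ^+ k)%VS.

Definition ext_even (L : falgType R) (j : 'Hom(V, L)) : {vspace L} :=
  (\sum_(k < (\dim {:V}).+1 | ~~ odd k) ext_power j k)%VS.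

(* Interior multiplication on forms is the antiderivation extending the inner
   product of vectors; these equations determine it. *)
Definition is_interior (L : falgType R) (j : 'Hom(V, L))
    (iprod : 'Hom(V, 'End(L))) : Prop :=
  (forall X, iprod X 1 = 0) /\
  (forall X v w, iprod X (j v * w) = dot X v *: w - j v * iprod X w).

(* The canonical linear isomorphism s : Cl -> Lambda^* V is the unique one with
   s 1 = 1 and e . phi = e /\ phi - e _| phi. *)
Definition is_canonical_isom (Cl : falgType R) (i : 'Hom(V, Cl))
    (L : falgType R) (j : 'Hom(V, L)) (iprod : 'Hom(V, 'End(L)))
    (s : 'Hom(Cl, L)) : Prop :=
  [/\ bijective s, s 1 = 1
    & forall v a, s (i v * a) = j v * s a - iprod v (s a)].

Definition is_reversal (Cl : falgType R) (i : 'Hom(V, Cl))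
    (tr : 'End(Cl)) : Prop :=
  [/\ tr 1 = 1, forall v, tr (i v) = i v
    & forall a b, tr (a * b) = tr b * tr a].

Definition is_orthonormal_frame (n : nat) (e : n.-tuple V) : Prop :=
  basis_of {:V} e /\
  (forall k l : 'I_n, dot (tnth e k) (tnth e l) = (k == l)%:R).

(* An orientation of V is given by one of its positively oriented orthonormal
   frames e; nu depends only on the orientation. *)
Definition volume (Cl : falgType R) (i : 'Hom(V, Cl)) (n : nat)
    (e : n.-tuple V) : Cl := \prod_(k < n) i (tnth e k).

Section FixAlgebra.
Variables (Cl L : falgType R) (iprod : 'Hom(V, 'End(L))) (s : 'Hom(Cl, L)).

(* Interior multiplication transported from forms to Cl; (s^-1)%VF is the
   inverse map because s is assumed bijective. *)
Definition cl_interior (X : V) (a : Cl) : Cl := (s^-1)%VF (iprod X (s a)).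

Definition interiors (T : Cl) : {vspace Cl} :=
  limg (linfun (fun X => cl_interior X T)).

Lemma interiorsP (T a : Cl) :
  reflect (exists X, a = cl_interior X T) (a \in interiors T).
Proof.
have lin : linear (fun X => cl_interior X T).
  by move=> c X Y; rewrite /cl_interior linearP add_lfunE scale_lfunE linearP.
pose mixin := GRing.isSemilinear.Build _ _ _ _ _ (GRing.semilinear_linear lin).
pose F : {linear V -> Cl} := HB.pack (fun X => cl_interior X T) mixin.
apply: (iffP memv_imgP) => [[X _ ->]|[X ->]].
  by exists X; rewrite (lfunE F).
by exists X; rewrite ?memvf // (lfunE F).
Qed.

Definition fix_algebra (T : Cl) : {vspace Cl} := lie_gen (interiors T).

Definition holonomy_algebra (T : Cl) : {vspace Cl} :=
  commv (fix_algebra T) (fix_algebra T).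

End FixAlgebra.

(* An irreducible real Cl-module S with a scalar product for which unit vectors
   of V act orthogonally. *)
Definition is_spinor_module (Cl : falgType R) (i : 'Hom(V, Cl))
    (S : vectType R) (rho : 'Hom(Cl, 'End(S)))
    (sdot : {dot S for @idfun R}) : Prop :=
  [/\ rho 1 = \1%VF,
      forall a b, rho (a * b) = (rho a \o rho b)%VF,
      ({:S} != 0)%VS,
      forall U : {vspace S}, (forall a, (rho a @: U <= U)%VS) ->
        U = 0%VS \/ U = fullv
    & forall v, dot v v = 1 -> forall x y,
        sdot (rho (i v) x) (rho (i v) y) = sdot x y].

(* T acts on S as x (x) x : psi |-> <psi, x> x. *)
Definition acts_as_square (Cl : falgType R) (S : vectType R)
    (rho : 'Hom(Cl, 'End(S))) (sdot : {dot S for @idfun R}) (x : S) (T : Cl) :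
  Prop := forall psi, rho T psi = sdot psi x *: x.

End CliffordAlgebra.

(* Main.v *)
(* For every T, X _| T = (th T X - X T) / 2, where th is the grading involution
   of Cl; when th T = T this is a_X / 2 with a_X = T X - X T.  In (i) and (iii),
   T X T = 0, and expanding the brackets with this relation gives
     [[a_X, a_Y], a_Z] = c (<Y, Z> a_X - <X, Z> a_Y)   with c = 8, resp. c = 1.
   Up to scaling this is the triple relation satisfied by the boosts of
   so(n,1), whose brackets are the rotations; it determines all brackets in the
   Lie algebra generated by the a_X.  For even n, conjugation by the volume
   element is th, which separates boosts from rotations and yields injectivity.
   The products of spinor squares in (ii) and (iii) are computed in the spinor
   representation, which is faithful for even n, and for odd n on the elements
   fixed by the volume element, because a proper two-sided ideal of Cl contains
   no nonzero homogeneous element.  In (ii), T X T = 0 and T and th T lie in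
   complementary ideals of Cl, so that all products of the X _| T vanish. *)

Require Import Defs.
From HB Require Import structures.
From mathcomp Require Import all_boot all_order all_algebra all_field.
From mathcomp Require Import reals sesquilinear ring ssrAC.

Set Implicit Arguments.
Unset Strict Implicit.
Unset Printing Implicit Defensive.

Import Order.TTheory GRing.Theory Num.Theory.
Local Open Scope ring_scope.

(** * Clifford algebras are generated by vectors *)

Section CliffordInduction.
Variables (R : realType) (V : vectType R) (q : V -> R).
Variables (A : falgType R) (i : 'Hom(V, A)).
Hypothesis hA : is_clifford_algebra q i.

(* The inclusion of the subalgebra generated by V, preceded by the map into it
   given by the universal property, is the identity by uniqueness. *)
Lemma clifford_agenv : agenv (limg i) = fullv.
Proof.
case: hA => sq_i univ.
pose B := <<limg i>>%AS.
have iB v : i v \in B.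
  by apply: (subvP (sub_agenv _)); apply: memv_img; apply: memvf.
pose j : 'Hom(V, subvs_of B) := linfun (vsproj B \o i).
(* The unit of a subalgebra is a priori only an idempotent of [A]; here it is [1], because [agenv]
   contains [1]. *)
have algid_B : algid B = 1.
  apply/eqP; rewrite algid_eq1; apply: (subvP (sub1_agenv _)).
  exact: memv_line.
have vj v : vsval (j v) = i v by rewrite lfunE /= vsprojK.
have sq_j v : j v * j v = (q v)%:A.
  by apply: val_inj; rewrite /= vj sq_i algid_B.
have [f [fE _]] := univ (subvs_of B) j sq_j.
have [g [gE uniq_g]] := univ A i sq_i.
pose h0 : {linear A -> A} := vsval \o f.
have h0M : monoid_morphism h0.
  by split=> [|x y]; rewrite /h0 /= ?rmorph1 ?rmorphM //= algid_B.
pose h : {lrmorphism A -> A} :=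
  HB.pack (h0 : A -> A) h0 (GRing.isMonoidMorphism.Build A A h0 h0M).
have hE v : h (i v) = i v by rewrite /= fE vj.
apply/eqP; rewrite eqEsubv subvf; apply/subvP => a _.
have idE : idfun a = g a by apply: (uniq_g idfun).
have -> : a = h a by rewrite (uniq_g h hE) -idE.
exact: subvsP.
Qed.

(** Induction principle: products of vectors arise from [1] by repeated left multiplication, and
    they span [A]. *)
Lemma clifford_fullv (W : {vspace A}) :
  1 \in W -> (forall v a, a \in W -> i v * a \in W) -> W = fullv.
Proof.
move=> W1 WM; apply/eqP; rewrite eqEsubv subvf -clifford_agenv /=.
apply: agenv_sub_modl; first by rewrite -memvE.
by apply/prodvP => _ a /memv_imgP[v _ ->] /WM.
Qed.

(** The equalizer of two linear maps is a subspace, so the induction principle proves linear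
    identities. The exterior algebra is covered too, as the Clifford algebra of the form [0]. *)
Lemma clifford_eq (B : vectType R) (f g : {linear A -> B}) :
  f 1 = g 1 -> (forall v a, f a = g a -> f (i v * a) = g (i v * a)) ->
  f =1 g.
Proof.
move=> fg1 fgM a.
have ker b : (b \in lker (linfun f - linfun g)) = (f b == g b).
  by rewrite memv_ker add_lfunE opp_lfunE !lfunE subr_eq0.
suff eq_full : lker (linfun f - linfun g) = fullv.
  by apply/eqP; rewrite -ker eq_full memvf.
apply: clifford_fullv => [|v b]; rewrite !ker; first exact/eqP.
by move=> /eqP/fgM/eqP.
Qed.

End CliffordInduction.

(** * Bilinear calculus of the inner product *)

Section Dot.
Variables (R : realType) (V : vectType R) (dot : {dot V for @idfun R}).

Lemma dotC v w : dot v w = dot w v.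
Proof. by rewrite hermC expr0 mul1r. Qed.

Lemma dotDr u v w : dot u (v + w) = dot u v + dot u w.
Proof. exact: raddfD. Qed.

Lemma dotZr c v w : dot v (c *: w) = c * dot v w.
Proof. exact: linearr_subproof. Qed.

Lemma dotDl u v w : dot (v + w) u = dot v u + dot w u.
Proof. by rewrite -!(dotC u) dotDr. Qed.

Lemma dotZl c v w : dot (c *: v) w = c * dot v w.
Proof. by rewrite dotC dotZr dotC. Qed.

Lemma dot0l v : dot 0 v = 0.
Proof. by rewrite -(scale0r v) dotZl mul0r. Qed.

Lemma dot_gt0 v : v != 0 -> 0 < dot v v.
Proof. exact: neq0_dnorm_gt0. Qed.

Lemma dot_eq0 v : dot v v = 0 -> v = 0.
Proof. by move=> v0; apply/eqP/contraT => /dot_gt0; rewrite v0 ltxx. Qed.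

End Dot.

(** * The grading involution and interior multiplication *)

Section Grading.
Variables (R : realType) (V : vectType R) (dot : {dot V for @idfun R}).

Section Involution.
Variables (q : V -> R) (A : falgType R) (i : 'Hom(V, A)).
Hypothesis hA : is_clifford_algebra q i.

(** Negating vectors leaves their squares unchanged, so the universal property extends the negation
    to an algebra morphism. *)
Lemma clifford_involution :
  exists th : {lrmorphism A -> A}, forall v, th (i v) = - i v.
Proof.
case: hA => sq_i univ.
have sqN v : (- i v) * (- i v) = (q v)%:A.
  by rewrite mulrNN sq_i.
have [th [thE _]] := univ A (\- i) sqN.
by exists th => v; rewrite thE.
Qed.

Variable th : {lrmorphism A -> A}.
Hypothesis thE : forall v, th (i v) = - i v.

Lemma involutionK : involutive th.
Proof.
apply: (clifford_eq hA (f := th \o th) (g := idfun)) => [|v a].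
  by rewrite /= !rmorph1.
by rewrite /= => IH; rewrite !rmorphM /= thE rmorphN /= thE opprK IH.
Qed.

End Involution.

Section Forms.
Variables (L : falgType R) (j : 'Hom(V, L)) (iprod : 'Hom(V, 'End(L))).
Hypotheses (hL : is_exterior_algebra j) (hiprod : is_interior dot j iprod).

(** On [j v * w] the mixed terms [dot Y v *: iprod X w] and [dot X v *: iprod Y w] occur with
    opposite signs; what remains is the induction hypothesis. *)
Lemma interior_anticomm X Y w : iprod X (iprod Y w) = - iprod Y (iprod X w).
Proof.
case: hiprod => i1 iM.
suff fg : iprod X \o iprod Y =1 \- (iprod Y \o iprod X) by apply: fg.
apply: (clifford_eq hL) => [|v a] /=.
  by rewrite !i1 !linear0.
move=> IH; rewrite !iM !linearB !linearZ /= !iM IH.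
by rewrite mulrN opprK scalerN opprD addrA addrAC [RHS]addrC opprK.
Qed.

Variable th : {lrmorphism L -> L}.
Hypothesis thE : forall v, th (j v) = - j v.

Lemma involution_interior X w : th (iprod X w) = - iprod X (th w).
Proof.
case: hiprod => i1 iM.
suff fg : th \o iprod X =1 \- (iprod X \o th) by apply: fg.
apply: (clifford_eq hL) => [|v a] /=.
  by rewrite rmorph1 !i1 !linear0.
move=> IH; rewrite !iM linearB linearZ /= !rmorphM /= !thE IH.
by rewrite !mulNr (linearN (iprod X)) /= iM !opprK mulrN.
Qed.

Lemma involution_ext_even w : w \in ext_even j -> th w = w.
Proof.
have pow k a : a \in ext_power j k -> th a = (-1) ^+ k *: a.
  (* The kernel of [g l] is the eigenspace of [th] for [(-1) ^+ l]; as a subspace it can be compared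
     with the product of subspaces [ext_power j l]. *)
  pose g l := linfun th - (-1) ^+ l *: (\1 : 'End(L))%VF.
  have gP l b : (b \in lker (g l)) = (th b == (-1) ^+ l *: b).
    by rewrite memv_ker add_lfunE opp_lfunE lfunE scale_lfunE id_lfunE subr_eq0.
  suff /subvP sub : (ext_power j k <= lker (g k))%VS by move/sub; rewrite gP =>
    /eqP.
  rewrite /ext_power; elim: k {a} => [|k IH].
    apply/subvP => a; rewrite gP expv0 => /vlineP[c ->].
    by rewrite linearZ /= rmorph1 scale1r.
  rewrite expvSl; apply/prodvP => _ b /memv_imgP[v _ ->] /(subvP IH).
  rewrite !gP rmorphM /= thE => /eqP ->.
  by rewrite -scalerAr exprS mulN1r scaleNr mulNr scalerN.
case/memv_sumP => u uE ->; rewrite linear_sum; apply: eq_bigr => k ek.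
by rewrite /= (pow k) ?uE // -signr_odd (negPf ek) scale1r.
Qed.

End Forms.

(** * Interior multiplication as a twisted commutator *)

Section Clifford.
Variables (Cl : falgType R) (i : 'Hom(V, Cl)).
Hypothesis hCl : is_Cl dot i.

Lemma cliff_sq v : i v * i v = - (dot v v)%:A.
Proof. by case: hCl => -> _; rewrite scaleNr. Qed.

Lemma cliff_anticomm v w : i v * i w = - (2 * dot v w)%:A - i w * i v.
Proof.
(* Polarization of [cliff_sq]. *)
have -> : i v * i w = i (v + w) * i (v + w) - i v * i v - i w * i w - i w * i v.
  apply/eqP; rewrite eq_sym !subr_eq linearD mulrDl !mulrDr /=.
  by rewrite [eqbLHS](AC (2*2) (2*3*4*1)).
congr (_ - _); rewrite !cliff_sq !opprK -!scaleNr -!scalerDl dotDl !dotDr.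
by congr (_ *: _); rewrite (dotC dot w v); ring.
Qed.

Variables (L : falgType R) (j : 'Hom(V, L)) (iprod : 'Hom(V, 'End(L))).
Hypotheses (hL : is_exterior_algebra j) (hiprod : is_interior dot j iprod).
Variable s : 'Hom(Cl, L).
Hypothesis hs : is_canonical_isom i j iprod s.
Variable th : {lrmorphism Cl -> Cl}.
Hypothesis thE : forall v, th (i v) = - i v.

(** The right-hand side obeys the antiderivation rule of [iprod]: with value [d] at [b], it has
    value [dot X v *: b - i v * d] at [i v * b]. Under [s] the factor [i v] becomes wedge minus
    interior product, and [interior_anticomm] matches the interior parts. *)
Lemma cl_interiorE X a :
  cl_interior iprod s X a = 2^-1 *: (th a * i X - i X * a).
Proof.
case: hs => bij_s s1 sM; case: hiprod => i1 iM.
suff fg : iprod X \o s =1 s \o (2^-1 \*: (i X \o* th \- i X \*o idfun)).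
  rewrite /cl_interior -[iprod X (s a)]/((iprod X \o s) a) fg /= lker0_lfunK //.
  by apply/lker0P/bij_inj.
apply: (clifford_eq hCl) => [|v b] /=.
  by rewrite rmorph1 mul1r mulr1 subrr scaler0 s1 linear0 i1.
set d := _ *: _ => IH.
have -> : 2^-1 *: (th (i v * b) * i X - i X * (i v * b)) =
    dot X v *: b - i v * d.
  have -> : dot X v *: b = 2^-1 *: ((2 * dot X v) *: b).
    by rewrite scalerA mulKf ?pnatr_eq0.
  rewrite /d -scalerAr -scalerBr rmorphM /= thE mulrBr !mulrA mulNr.
  rewrite (cliff_anticomm X v) mulrBl !mulNr -scalerAl mul1r.
  by congr (_ *: _); rewrite !opprB opprK addrC addrAC addrC.
rewrite sM !linearB linearZ /= sM iM (interior_anticomm hL hiprod).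
by move: IH => /= ->; rewrite opprK opprB addrA addrAC.
Qed.

Variable thL : {lrmorphism L -> L}.
Hypothesis thLE : forall v, thL (j v) = - j v.

Lemma involution_canonical a : s (th a) = thL (s a).
Proof.
case: hs => _ s1 sM.
suff fg : s \o th =1 thL \o s by apply: fg.
apply: (clifford_eq hCl) => [|v b] /=; first by rewrite rmorph1 s1 rmorph1.
move=> IH; rewrite rmorphM /= thE mulNr linearN /= !sM IH rmorphB rmorphM /=
  thLE.
by rewrite (involution_interior hL hiprod thLE) opprB opprK mulNr addrC.
Qed.

(** Turns evenness of a form into the condition used in the commutator computations; [s] intertwines
    the two gradings and is injective. *)
Lemma involution_even a : s a \in ext_even j -> th a = a.
Proof.
case: hs => /bij_inj s_inj _ _ /(involution_ext_even thLE) sa.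
by apply: s_inj; rewrite involution_canonical.
Qed.

End Clifford.
End Grading.

(** * Homogeneous elements of ideals and the volume element *)

Section Monomials.
Variables (R : realType) (V : vectType R) (dot : {dot V for @idfun R}).
Variables (Cl : falgType R) (i : 'Hom(V, Cl)).
Hypothesis hCl : is_Cl dot i.
Variable th : {lrmorphism Cl -> Cl}.
Hypothesis thE : forall v, th (i v) = - i v.

Lemma cliff_orth v w : dot v w = 0 -> i v * i w = - (i w * i v).
Proof.
by move=> vw; rewrite (cliff_anticomm hCl) vw mulr0 scale0r oppr0 add0r.
Qed.

Lemma cliff_unit_sq v : dot v v = 1 -> i v * i v = -1.
Proof. by move=> vv; rewrite (cliff_sq hCl) vv scale1r. Qed.

Lemma cliff_unit v : dot v v = 1 -> i v \is a GRing.unit.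
Proof.
move=> /cliff_unit_sq vv; apply/unitrP; exists (- i v).
by rewrite mulNr mulrN vv opprK.
Qed.

(** With each new vector placed on the right, elements read [b + c * i v] with [b] and [c] free of
    [v], so that inductions peel off one vector. For an orthonormal list this is the subalgebra
    generated by it. *)
Fixpoint monomials (r : seq V) : {vspace Cl} :=
  if r is v :: r' then (monomials r' + amulr (i v) @: monomials r')%VS
  else 1%VS.

Lemma monomials_consP v r a :
  reflect
    (exists b c, [/\ b \in monomials r, c \in monomials r & a = b + c * i v])
    (a \in monomials (v :: r)).
Proof.
apply: (iffP memv_addP) => [[b rb [_ /memv_imgP[c rc ->] ->]]|].
  by exists b, c; rewrite lfunE.
case=> b [c [rb rc ->]].
exists b => //; exists (c * i v) => //; apply/memv_imgP.
by exists c; rewrite ?lfunE.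
Qed.

Lemma monomials_comm v r a : {in r, forall w, dot v w = 0} ->
  a \in monomials r -> i v * a = th a * i v.
Proof.
elim: r a => [|w r IH] a vr /=.
  by case/vlineP => c ->; rewrite linearZ /= rmorph1 -scalerAr -scalerAl mulr1
    mul1r.
have vr' : {in r, forall u, dot v u = 0}.
  by move=> u ru; apply: vr; rewrite inE ru orbT.
case/monomials_consP => b [c [rb rc ->]].
rewrite rmorphD rmorphM /= thE mulrDr mulrDl mulrA !IH // -!mulrA.
by rewrite (cliff_orth (vr w _)) ?mem_head // mulNr.
Qed.

Lemma monomials_involution r a : a \in monomials r -> th a \in monomials r.
Proof.
elim: r a => [|w r IH] a.
  by case/vlineP => c ->; rewrite linearZ /= rmorph1 memvZ ?memv_line.
case/monomials_consP => b [c [rb rc ->]].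
apply/monomials_consP; exists (th b), (- th c); rewrite memvN !IH //.
by rewrite rmorphD rmorphM /= thE mulrN mulNr.
Qed.

Lemma monomials_mull r v a :
  {in r, forall w, dot w w = 1} -> pairwise (fun w u => dot w u == 0) r ->
  v \in r -> a \in monomials r -> i v * a \in monomials r.
Proof.
elim: r a => // w r IH a unit_r /=/andP[/allP w_r pr_r] v_r.
have orth_w : {in r, forall u, dot w u = 0} by move=> u /w_r /eqP.
have unit_r' : {in r, forall u, dot u u = 1}.
  by move=> u ru; apply: unit_r; rewrite inE ru orbT.
case/monomials_consP => b [c [rb rc ->]]; apply/monomials_consP.
move: v_r; rewrite inE => /orP[/eqP->|v_r]; last first.
  by exists (i v * b), (i v * c); rewrite !IH // mulrDr mulrA.
(* By [monomials_comm], [w (b + c w) = th b w + th c w w], and [w w = -1]. *)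
exists (- th c), (th b); rewrite memvN !monomials_involution //; split=> //.
rewrite mulrDr mulrA !(monomials_comm orth_w) // -mulrA cliff_unit_sq.
  by rewrite mulrN1 addrC.
by apply: unit_r; rewrite mem_head.
Qed.

Lemma monomials_full r :
  {in r, forall w, dot w w = 1} -> pairwise (fun w u => dot w u == 0) r ->
  <<r>>%VS = fullv -> monomials r = fullv.
Proof.
move=> unit_r pr_r span_r; apply: (clifford_fullv hCl) => [|v a ra].
  elim: r {unit_r pr_r span_r} => [|w r IH]; first exact: memv_line.
  by apply: (subvP (addvSl _ _)).
have : v \in <<r>>%VS by rewrite span_r memvf.
move/(coord_span (X := in_tuple r)) ->.
rewrite linear_sum mulr_suml; apply: memv_suml => k _.
rewrite linearZ /= -scalerAl memvZ //.
by apply: monomials_mull => //; apply: mem_nth.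
Qed.

(* For a = b + c v homogeneous of sign z, with b and c free of v, conjugation
   by v gives back z (b - c v). *)
Lemma graded_ideal0 (I : {vspace Cl}) r (z : R) a :
    (forall v b, b \in I -> i v * b \in I /\ b * i v \in I) -> 1 \notin I ->
    {in r, forall w, dot w w = 1} -> pairwise (fun w u => dot w u == 0) r ->
  z * z = 1 -> a \in monomials r -> a \in I -> th a = z *: a -> a = 0.
Proof.
move=> I_ideal I1; elim: r z a => [|v r IH] z a unit_r pr_r zz.
  case/vlineP => c -> Ic _; have [->|nzc] := eqVneq c 0; first by rewrite
    scale0r.
  by case/negP: I1; rewrite -[1](scalerK nzc) memvZ.
move: pr_r => /=/andP[/allP v_r pr_r].
have orth_v : {in r, forall u, dot v u = 0} by move=> u /v_r /eqP.
have unit_v : dot v v = 1 by apply: unit_r; rewrite mem_head.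
have {}unit_r : {in r, forall u, dot u u = 1}.
  by move=> u ru; apply: unit_r; rewrite inE ru orbT.
have half (b : Cl) : b = 2^-1 *: (b + b).
  by rewrite -mulr2n -scaler_nat scalerA mulVf ?scale1r ?pnatr_eq0.
case/monomials_consP => b0 [c0 [rb0 rc0 a_eq]] Ia tha.
(* Projections of [b0] to sign [z] and of [c0] to sign [- z]. They still represent [a], because
   [a = (a + z th a) / 2]. *)
pose b := 2^-1 *: (b0 + z *: th b0); pose c := 2^-1 *: (c0 - z *: th c0).
have rb : b \in monomials r.
  by rewrite memvZ // memvD // memvZ // monomials_involution.
have rc : c \in monomials r.
  by rewrite memvZ // memvB // memvZ // monomials_involution.
have thb : th b = z *: b.
  rewrite linearZ linearD linearZ /= (involutionK hCl thE) /b [RHS]scalerA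
    (mulrC z) -scalerA.
  by congr (_ *: _); rewrite scalerDr scalerA zz scale1r addrC.
have thc : th c = - z *: c.
  rewrite linearZ linearB linearZ /= (involutionK hCl thE) /c [RHS]scalerA
    (mulrC (- z)) -scalerA.
  by congr (_ *: _); rewrite scalerBr scalerA mulNr zz scaleN1r opprK scaleNr
    addrC.
have {a_eq}a_eq : a = b + c * i v.
  have -> : a = 2^-1 *: (a + z *: th a) by rewrite tha scalerA zz scale1r -half.
  rewrite a_eq rmorphD rmorphM /= thE /b /c -scalerAl -scalerDr.
  by congr (_ *: _); rewrite mulrN scalerBr mulrBl -scalerAl addrACA.
clearbody b c.
have conj_a : z *: (i v * a * i v) = - b + c * i v.
  rewrite a_eq mulrDr mulrA !(monomials_comm orth_v) // thb thc.
  rewrite mulrDl -!scalerAl -[b * _ * _]mulrA cliff_unit_sq // mulrN1.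
  rewrite -[c * _ * _]mulrA cliff_unit_sq // mulrN1 scalerDr !scalerA mulrN zz.
  by rewrite scale1r scaleN1r mulNr opprK.
have b0' : b = 0.
  apply: (IH z) => //.
  have -> : b = 2^-1 *: (a - z *: (i v * a * i v)).
    by rewrite conj_a a_eq opprD opprK addrACA subrr addr0 -half.
  rewrite memvZ // memvB // memvZ //.
  by case: (I_ideal v _ Ia) => /(I_ideal v)[].
(* Once [b = 0], right multiplication by [v] recovers [c] up to sign, so [c] lies in the ideal as
   well, with the opposite sign [- z]. *)
have c0' : c = 0.
  apply: (IH (- z)) => //; first by rewrite mulrNN.
  have -> : c = - (a * i v).
    by rewrite a_eq b0' add0r -mulrA cliff_unit_sq // mulrN1 opprK.
  by rewrite memvN; case: (I_ideal v _ Ia).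
by rewrite a_eq b0' c0' mul0r addr0.
Qed.

(** * Orthonormal frames and the volume element *)

Section Frame.
Variables (n : nat) (e : n.-tuple V).
Hypothesis he : is_orthonormal_frame dot e.

Lemma frame_unit : {in e, forall w, dot w w = 1}.
Proof. by case: he => _ on w /tnthP[k ->]; rewrite on eqxx. Qed.

Lemma frame_inj : injective (tnth e).
Proof.
case: he => _ on k l kl; apply/eqP/contraT => nkl.
by have := on k l; rewrite (negPf nkl) -kl on eqxx => /eqP; rewrite oner_eq0.
Qed.

Lemma frame_uniq : uniq e.
Proof. exact/tuple_uniqP/frame_inj. Qed.

Lemma frame_orth : {in e &, forall v w, v != w -> dot v w = 0}.
Proof.
case: he => _ on v w /tnthP[k ->] /tnthP[l ->]; rewrite on.
by case: (eqVneq k l) => [->|//]; rewrite eqxx.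
Qed.

Lemma frame_pairwise : pairwise (fun w u => dot w u == 0) e.
Proof.
have := frame_uniq; rewrite uniq_pairwise; apply: sub_in_pairwise (allss e).
by move=> v w ev ew vw; rewrite frame_orth.
Qed.

Lemma frame_span : <<e>>%VS = fullv.
Proof. by case: he => /span_basis. Qed.

Lemma frame_coord v : v = \sum_(k < n) dot v (tnth e k) *: tnth e k.
Proof.
have {1}-> : v = \sum_(k < n) coord e k v *: tnth e k.
  rewrite {1}(coord_span (X := e) (v := v)) ?frame_span ?memvf //.
  by apply: eq_bigr => k _; rewrite (tnth_nth 0).
apply: eq_bigr => k _; congr (_ *: _).
rewrite {2}(coord_span (X := e) (v := v)) ?frame_span ?memvf //.
rewrite dotC raddf_sum (bigD1 k) //= big1 => [|l lk]; rewrite -(tnth_nth 0)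
  dotZr.
  by case: he => _ ->; rewrite eqxx mulr1 addr0.
by case: he => _ ->; rewrite eq_sym (negPf lk) mulr0.
Qed.

Lemma volumeE : volume i e = \prod_(v <- e) i v.
Proof. by rewrite big_tuple. Qed.

Lemma volume_unit : volume i e \is a GRing.unit.
Proof.
by apply: rpred_prod => k _; apply/cliff_unit/frame_unit/mem_tnth.
Qed.

Lemma volume_comm v : i v * volume i e = (-1) ^+ n.-1 *: (volume i e * i v).
Proof.
(* Moving [w] through the product costs one sign for each factor other than [w]; in a frame exactly
   one factor equals [w], which leaves [n.-1] signs. *)
have prod_comm w (r : seq V) : {in r, forall u, u != w -> dot w u = 0} ->
    i w * (\prod_(u <- r) i u) =
    (-1) ^+ count (predC1 w) r *: ((\prod_(u <- r) i u) * i w).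
  elim: r => [|u r IH] wr; first by rewrite big_nil mulr1 mul1r scale1r.
  rewrite !big_cons /= exprD -scalerA -[in RHS]mulrA scalerAr -IH => [|x rx];
    last first.
    by apply: wr; rewrite inE rx orbT.
  rewrite !mulrA scalerAl; congr (_ * _); have [->|uw] := eqVneq u w.
    by rewrite scale1r.
  by rewrite (cliff_orth (wr u _ uw)) ?mem_head // scaleN1r.
rewrite [in LHS](frame_coord v) {2}(frame_coord v) !linear_sum mulr_suml
  mulr_sumr.
rewrite scaler_sumr; apply: eq_bigr => k _; rewrite !linearZ /= -scalerAl
  -scalerAr.
rewrite scalerA mulrC -scalerA; congr (_ *: _); rewrite volumeE prod_comm => [|u
  eu uk].
  congr (_ ^+ _ *: _).
  have := count_predC (pred1 (tnth e k)) e; rewrite (count_uniq_mem _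
    frame_uniq) mem_tnth size_tuple.
  by move/(congr1 predn).
by rewrite frame_orth // ?mem_tnth // eq_sym.
Qed.

Lemma volume_involution : th (volume i e) = (-1) ^+ n *: volume i e.
Proof.
suff thP (r : seq V) :
    th (\prod_(v <- r) i v) = (-1) ^+ size r *: \prod_(v <- r) i v.
  by rewrite volumeE thP size_tuple.
elim: r => [|v r IH].
  by rewrite big_nil rmorph1 scale1r.
by rewrite !big_cons rmorphM /= thE IH -scalerAr exprS mulN1r scaleNr mulNr
  scalerN.
Qed.

End Frame.
End Monomials.

(** * Boosts and rotations of so(n,1) *)

Section BracketTheory.
Variables (K : fieldType) (A : falgType K).
Implicit Types a b c : A.

Lemma lie_bracketC a b : lie_bracket a b = - lie_bracket b a.
Proof. by rewrite opprB. Qed.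

Lemma lie_bracketDr a b c :
  lie_bracket a (b + c) = lie_bracket a b + lie_bracket a c.
Proof. by rewrite /lie_bracket mulrDr mulrDl opprD addrACA. Qed.

Lemma lie_bracketDl a b c :
  lie_bracket (a + b) c = lie_bracket a c + lie_bracket b c.
Proof. by rewrite /lie_bracket mulrDr mulrDl opprD addrACA. Qed.

Lemma lie_bracketZr k a b : lie_bracket a (k *: b) = k *: lie_bracket a b.
Proof. by rewrite /lie_bracket -scalerAl -scalerAr scalerBr. Qed.

Lemma lie_bracketZl k a b : lie_bracket (k *: a) b = k *: lie_bracket a b.
Proof. by rewrite /lie_bracket -scalerAl -scalerAr scalerBr. Qed.

Lemma lie_bracket_sumr (I : finType) a (F : I -> A) :
  lie_bracket a (\sum_k F k) = \sum_k lie_bracket a (F k).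
Proof. by rewrite /lie_bracket mulr_sumr mulr_suml -sumrB. Qed.

Lemma lie_bracket_suml (I : finType) a (F : I -> A) :
  lie_bracket (\sum_k F k) a = \sum_k lie_bracket (F k) a.
Proof. by rewrite /lie_bracket mulr_sumr mulr_suml -sumrB. Qed.

Lemma lie_jacobi a b c :
  lie_bracket a (lie_bracket b c) =
  lie_bracket (lie_bracket a b) c + lie_bracket b (lie_bracket a c).
Proof.
rewrite /lie_bracket !mulrBl !mulrBr !mulrA !opprB.
by rewrite [RHS](AC ((2*2)*(2*2)) ((1*8*(3*6))*((2*5)*(4*7)))) /= addNr addNr
  !addr0.
Qed.

End BracketTheory.

Lemma lie_isom_sym (K : fieldType) (A B : falgType K)
    (g : {vspace A}) (h : {vspace B}) :
  lie_closed g -> lie_isom g h -> lie_isom h g.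
Proof.
move=> g_closed [f [f_inj fg fM]].
(* Only the restriction of [f] to [g] is injective. Projecting to [g] first and applying a
   pseudo-inverse gives preimages up to the kernel of [projv g]; the second projection moves them
   into [g]. *)
pose F := (f \o projv g)%VF; pose f' := (projv g \o F^-1)%VF.
have f'g b : f' b \in g by rewrite lfunE memv_proj.
have f'K b : b \in h -> f (f' b) = b.
  rewrite -fg => /memv_imgP[a ga ->].
  have Fa : f a \in limg F by apply/memv_imgP; exists a; rewrite ?memvf //
    comp_lfunE projv_id.
  by have := limg_lfunVK Fa; rewrite [f' _]comp_lfunE comp_lfunE.
have fK a : a \in g -> f' (f a) = a.
  by move=> ga; apply: f_inj => //; rewrite f'K // -fg memv_img.
exists f'; split=> [b c hb hc eq_bc||b c hb hc].
- by rewrite -(f'K b) // eq_bc f'K.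
- apply/vspaceP => a; apply/memv_imgP/idP => [[b _ ->]|ga]; first exact: f'g.
  by exists (f a); rewrite ?fK // -fg memv_img.
apply: f_inj => //; first exact: g_closed.
rewrite fM // !f'K //.
by rewrite -(f'K b) // -(f'K c) // -fM // -fg memv_img // g_closed.
Qed.

(** * Block form of the matrices in [so_n1] *)

Section LorentzMatrices.
Variables (K : numFieldType) (n : nat).
Local Notation inner k := (widen_ord (leqnSn n) k).
Local Notation outer := (@ord_max n).

Lemma inner_neq_outer k : (inner k == outer) = false.
Proof. by apply/negbTE; rewrite -val_eqE /= neq_ltn ltn_ord. Qed.

Lemma ord_inner_outer (r : 'I_n.+1) : r = outer \/ exists k, r = inner k.
Proof.
have [/eqP rn|rn] := boolP (val r == n); first by left; apply: val_inj.
have ltr : (r < n)%N by rewrite ltn_neqAle rn -ltnS ltn_ord.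
by right; exists (Ordinal ltr); apply: val_inj.
Qed.

(** The defining equation read entry by entry, [outer] being the time-like index. Its corner entry
    says that twice [M outer outer] vanishes, which uses characteristic zero. *)
Lemma so_n1P (M : 'M[K]_n.+1) : reflect
  [/\ forall k l, M (inner k) (inner l) = - M (inner l) (inner k),
      forall k, M outer (inner k) = M (inner k) outer & M outer outer = 0]
  (M \in so_n1 K n).
Proof.
rewrite mem_so_n1.
have entry p q : (M^T *m lorentz_gram K n + lorentz_gram K n *m M) p q =
    M q p * (if q == outer then -1 else 1)
    + (if p == outer then -1 else 1) * M p q.
  by rewrite /lorentz_gram mxE mul_mx_diag mul_diag_mx !mxE.
apply: (iffP eqP) => [M0|[anti sym M0]].
  have M0' p q :=
    etrans (esym (entry p q)) (congr1 (fun N : 'M_n.+1 => N p q) M0).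
  split=> [k l|k|].
  - have := M0' (inner k) (inner l); rewrite !inner_neq_outer mxE mulr1 mul1r.
    by rewrite addrC => /eqP; rewrite addr_eq0 => /eqP.
  - have := M0' outer (inner k); rewrite inner_neq_outer eqxx mxE mulr1 mulN1r.
    by move/eqP; rewrite subr_eq0 => /eqP.
  - have := M0' outer outer; rewrite eqxx mxE mulrN1 mulN1r -opprD.
    by move/eqP; rewrite oppr_eq0 -mulr2n mulrn_eq0 /= => /eqP.
apply/matrixP => p q; rewrite entry mxE.
case: (ord_inner_outer p) => [->|[k ->]];
  case: (ord_inner_outer q) => [->|[l ->]];
  rewrite ?eqxx ?inner_neq_outer ?M0 ?mulr0 ?mul0r ?addr0 // ?sym.
- by rewrite mulr1 mulN1r subrr.
- by rewrite mulrN1 mul1r addNr.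
- by rewrite mulr1 mul1r anti addNr.
Qed.

Lemma so_n1_closed : lie_closed (so_n1 K n).
Proof.
move=> M N; rewrite !mem_so_n1 !addr_eq0 => /eqP soM /eqP soN; apply/eqP.
rewrite /lie_bracket linearB /= -!mulmxE !trmx_mul mulmxBl mulmxBr opprB.
rewrite -!mulmxA soM soN !mulmxN !(mulmxA _ (lorentz_gram _ _)) soM soN !mulNmx
  !opprK.
by rewrite !mulmxA.
Qed.

(** * Lie algebras generated by elements with the boost triple relation *)

Section Boosts.
Variables (A : falgType K) (a : 'I_n -> A).
Hypothesis a_triple : forall k l m,
  lie_bracket (lie_bracket (a k) (a l)) (a m) =
  (l == m)%:R *: a k - (k == m)%:R *: a l.

Definition boost (v : 'I_n -> K) : A := \sum_k v k *: a k.

(** The factor one half compensates that, for skew [w], each pair of indices is counted in both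
    orders. *)
Definition rotation (w : 'I_n -> 'I_n -> K) : A :=
  2^-1 *: \sum_k \sum_l w k l *: lie_bracket (a k) (a l).

Lemma eq_boost v v' : v =1 v' -> boost v = boost v'.
Proof. by move=> vv; apply: eq_bigr => k _ /=; rewrite vv. Qed.

Lemma eq_rotation w w' : w =2 w' -> rotation w = rotation w'.
Proof.
by move=> ww; congr (_ *: _); apply: eq_bigr => k _; apply: eq_bigr => l _ /=;
  rewrite ww.
Qed.

Lemma boostD v v' : boost v + boost v' = boost (fun k => v k + v' k).
Proof. by rewrite -big_split; apply: eq_bigr => k _ /=; rewrite scalerDl. Qed.

Lemma boostZ c v : c *: boost v = boost (fun k => c * v k).
Proof. by rewrite scaler_sumr; apply: eq_bigr => k _; rewrite scalerA. Qed.

Lemma rotationD w w' :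
  rotation w + rotation w' = rotation (fun k l => w k l + w' k l).
Proof.
rewrite -scalerDr -big_split; congr (_ *: _); apply: eq_bigr => k _ /=.
by rewrite -big_split; apply: eq_bigr => l _; rewrite scalerDl.
Qed.

Lemma rotationZ c w : c *: rotation w = rotation (fun k l => c * w k l).
Proof.
rewrite scalerA mulrC -scalerA; congr (_ *: _).
rewrite scaler_sumr; apply: eq_bigr => k _.
by rewrite scaler_sumr; apply: eq_bigr => l _; rewrite scalerA.
Qed.

Lemma bracket_boost v w :
  lie_bracket (boost v) (boost w) = rotation (fun k l => v k * w l - w k * v l).
Proof.
have -> : lie_bracket (boost v) (boost w) =
    \sum_k \sum_l (v k * w l) *: lie_bracket (a k) (a l).
  rewrite lie_bracket_suml; apply: eq_bigr => k _.
  rewrite lie_bracket_sumr; apply: eq_bigr => l _.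
  by rewrite lie_bracketZl lie_bracketZr scalerA.
set S := \sum_k _.
(* Exchanging the two indices in one copy of [S] makes the coefficients skew. *)
suff SS : S + S =
    \sum_k \sum_l (v k * w l - w k * v l) *: lie_bracket (a k) (a l).
  by rewrite /rotation -SS -mulr2n -scaler_nat scalerA mulVf ?scale1r
    ?pnatr_eq0.
rewrite {2}/S exchange_big /S -big_split /=; apply: eq_bigr => k _.
rewrite -big_split /=; apply: eq_bigr => l _.
by rewrite scalerBl (lie_bracketC (a l)) scalerN (mulrC (w k)).
Qed.

(** The triple relation leaves two sums, one over each index of [w]; they agree by skewness, which
    absorbs the factor one half. *)
Lemma bracket_rotation_gen w m : (forall k l, w k l = - w l k) ->
  lie_bracket (rotation w) (a m) = boost (w^~ m).
Proof.
move=> w_anti; rewrite lie_bracketZl lie_bracket_suml.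
have -> : boost (w^~ m) = 2^-1 *: (boost (w^~ m) + boost (w^~ m)).
  by rewrite -mulr2n -scaler_nat scalerA mulVf ?scale1r ?pnatr_eq0.
congr (_ *: _).
under eq_bigr => k _ do (rewrite lie_bracket_suml;
  under eq_bigr => l _ do rewrite lie_bracketZl a_triple scalerBr !scalerA).
have delta (F : 'I_n -> A) : \sum_k (k == m)%:R *: F k = F m.
  rewrite (bigD1 m) //= eqxx scale1r big1 ?addr0 // => k /negPf ->.
  exact: scale0r.
under eq_bigr => k _ do rewrite sumrB.
rewrite sumrB -sumrN; congr (_ + _).
  apply: eq_bigr => k _; rewrite -(delta (fun l => w k l *: a k)).
  by apply: eq_bigr => l _; rewrite scalerA mulrC.
rewrite -(delta (fun k => boost (w^~ k))); apply: eq_bigr => k _.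
rewrite -sumrN scaler_sumr; apply: eq_bigr => l _.
by rewrite scalerA w_anti mulNr scaleNr opprK mulrC.
Qed.

Lemma bracket_rotation_boost w v : (forall k l, w k l = - w l k) ->
  lie_bracket (rotation w) (boost v) = boost (fun k => \sum_l w k l * v l).
Proof.
move=> w_anti; rewrite lie_bracket_sumr.
under eq_bigr => m _ do rewrite lie_bracketZr bracket_rotation_gen //
  scaler_sumr.
rewrite exchange_big; apply: eq_bigr => k _ /=; rewrite scaler_suml.
by apply: eq_bigr => l _; rewrite scalerA mulrC.
Qed.

(** By the Jacobi identity a rotation acts as a derivation on [[a k, a l]], hence on the
    coefficients by the matrix commutator [w w' - w' w]. *)
Lemma bracket_rotation w w' : (forall k l, w k l = - w l k) ->
  lie_bracket (rotation w) (rotation w') =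
  rotation (fun k l => \sum_m w k m * w' m l - \sum_m w' k m * w m l).
Proof.
move=> w_anti; rewrite lie_bracketZr lie_bracket_sumr; congr (_ *: _).
under eq_bigr => k _.
  rewrite lie_bracket_sumr.
  under eq_bigr => l _ do
    rewrite lie_bracketZr lie_jacobi !bracket_rotation_gen // scalerDr.
  rewrite big_split /=; over.
rewrite big_split /=.
under [RHS]eq_bigr => k _ do (under eq_bigr => l _ do rewrite scalerBl; rewrite
  sumrB).
rewrite sumrB -sumrN; congr (_ + _).
  rewrite exchange_big [RHS]exchange_big; apply: eq_bigr => l _ /=.
  under eq_bigr => k _ do rewrite lie_bracket_suml scaler_sumr.
  rewrite exchange_big; apply: eq_bigr => k _ /=.
  rewrite scaler_suml; apply: eq_bigr => m _.
  by rewrite lie_bracketZl scalerA mulrC.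
apply: eq_bigr => k _.
under eq_bigr => l _ do rewrite lie_bracket_sumr scaler_sumr.
rewrite exchange_big -sumrN; apply: eq_bigr => l _ /=.
rewrite scaler_suml -sumrN; apply: eq_bigr => m _.
by rewrite lie_bracketZr scalerA w_anti mulrN scaleNr.
Qed.

(* Elements of so(n,1) are the matrices [[w, v], [v^T, 0]] with w skew. *)
Definition lorentz_map (M : 'M[K]_n.+1) : A :=
  boost (fun k => M (inner k) outer)
  + rotation (fun k l => M (inner k) (inner l)).

Lemma lorentz_map_linear : linear lorentz_map.
Proof.
move=> c M N; rewrite /lorentz_map scalerDr addrACA boostZ boostD rotationZ
  rotationD.
by congr (_ + _); [apply: eq_boost => k|apply: eq_rotation => k l]; rewrite
  !mxE.
Qed.

Lemma lorentz_map_morph : {in so_n1 K n &,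
  {morph lorentz_map : M N / lie_bracket M N >-> lie_bracket M N}}.
Proof.
move=> M N /so_n1P[M_anti M_sym M0] /so_n1P[N_anti N_sym N0].
rewrite [in RHS]/lorentz_map lie_bracketDl !lie_bracketDr bracket_boost.
rewrite bracket_rotation // bracket_rotation_boost //.
rewrite (lie_bracketC (boost _)) bracket_rotation_boost // -scaleN1r boostZ.
rewrite addrACA [RHS]addrACA [X in X + _]addrC addrCA -addrA rotationD.
rewrite addrA boostD /lorentz_map; congr (_ + _).
  (* [big_ord_recr] splits off the time-like index in the matrix products: its terms vanish in the
     boost part and give the bracket of two boosts in the rotation part. *)
  apply: eq_boost => k; rewrite !mxE !big_ord_recr /= M0 N0 !mulr0 !addr0.
  by rewrite mulN1r.
apply: eq_rotation => k l; rewrite !mxE !big_ord_recr /= M_sym N_sym.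
by rewrite opprD addrACA addrC.
Qed.

Lemma lorentz_map_inner k :
  a k = lorentz_map (delta_mx (inner k) outer + delta_mx outer (inner k)).
Proof.
rewrite /lorentz_map /rotation big1 ?scaler0 ?addr0 => [|l _].
  rewrite /boost (bigD1 k) //= big1 => [|l lk]; rewrite !mxE.
    by rewrite !eqxx inner_neq_outer !addr0 scale1r.
  rewrite inner_neq_outer addr0 eqxx andbT -val_eqE /= val_eqE (negPf lk).
  by rewrite scale0r.
rewrite big1 // => m _; rewrite !mxE !inner_neq_outer !andbF.
by rewrite addr0 scale0r.
Qed.

Lemma inner_so_n1 k :
  delta_mx (inner k) outer + delta_mx outer (inner k) \in so_n1 K n.
Proof.
apply/so_n1P; split=> [l m|l|].
- by rewrite !mxE !inner_neq_outer !andbF addr0 oppr0.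
- by rewrite !mxE !inner_neq_outer !eqxx (eq_sym outer) !inner_neq_outer add0r
  addr0 !andbT.
- by rewrite !mxE (eq_sym outer) inner_neq_outer !andbF addr0.
Qed.

Variable u : A.
Hypotheses (u_unit : u \is a GRing.unit)
  (u_anti : forall k, u * a k = - (a k * u)).
Hypothesis a_free : forall v, boost v = 0 -> v =1 (fun=> 0).

(* The rotations commute with u and the boosts anticommute with it, so the two
   parts of an element of the kernel vanish separately. *)
Lemma lorentz_map_inj : {in so_n1 K n, forall M, lorentz_map M = 0 -> M = 0}.
Proof.
move=> M soM; have /so_n1P[M_anti M_sym M0] := soM.
rewrite /lorentz_map; set b := boost _; set r := rotation _ => br0.
have ub : u * b = - (b * u).
  rewrite mulr_sumr mulr_suml -sumrN; apply: eq_bigr => k _.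
  by rewrite -scalerAr u_anti scalerN -scalerAl.
have ur : u * r = r * u.
  rewrite -scalerAr -scalerAl; congr (_ *: _); rewrite mulr_sumr mulr_suml.
  apply: eq_bigr => k _; rewrite mulr_sumr mulr_suml; apply: eq_bigr => l _.
  rewrite -scalerAr -scalerAl; congr (_ *: _).
  rewrite /lie_bracket mulrBr mulrBl; congr (_ - _);
  by rewrite mulrA u_anti mulNr -mulrA u_anti mulrN opprK mulrA.
have b0 : b = 0.
  have e1 : u * b + u * r = 0 by rewrite -mulrDr br0 mulr0.
  have e2 : - (u * b) + u * r = 0 by rewrite ub ur opprK -mulrDl br0 mul0r.
  have e3 : u * b + u * b = 0.
    by rewrite -[RHS](subrr (0 : A)) -{1}e1 -e2 opprD opprK addrACA subrr addr0.
  have /eqP : 2%:R *: (u * b) = 0 by rewrite scaler_nat mulr2n.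
  rewrite scaler_eq0 pnatr_eq0 /= => /eqP ub0.
  by apply: (mulrI u_unit); rewrite ub0 mulr0.
have r0 : r = 0 by rewrite -br0 b0 add0r.
have v0 k : M (inner k) outer = 0 by apply: (a_free b0).
have w0 k l : M (inner k) (inner l) = 0.
  (* The bracket of [r] with [a l] is the boost along column [l] of the rotation block, and
     [r = 0]. *)
  suff : boost (fun k => M (inner k) (inner l)) = 0 by move/a_free/(_ k).
  have <- := @bracket_rotation_gen (fun k l => M (inner k) (inner l)) l M_anti.
  by rewrite -/r r0 /lie_bracket mul0r mulr0 subr0.
apply/matrixP => p q; rewrite mxE.
by case: (ord_inner_outer p) => [->|[k ->]];
  case: (ord_inner_outer q) => [->|[l ->]];
  rewrite ?M_sym ?v0 ?w0.
Qed.

(** The image of [lorentz_map] consists of boosts and rotations, so it lies in the generated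
    algebra; it is also a Lie subalgebra containing every [a k], so the two agree. *)
Lemma lie_gen_boosts_isom :
  lie_isom (lie_gen <<[tuple a k | k < n]>>%VS) (so_n1 K n).
Proof.
pose g := lie_gen <<[tuple a k | k < n]>>%VS.
have ag k : a k \in g.
  by apply: (subvP (sub_lie_gen _)); rewrite memv_span // map_f ?mem_enum.
have fE M : linfun lorentz_map M = lorentz_map M.
  pose mixin := GRing.isSemilinear.Build _ _ _ _ _
    (GRing.semilinear_linear lorentz_map_linear).
  pose F : {linear 'M[K]_n.+1 -> A} := HB.pack lorentz_map mixin.
  exact: (lfunE F).
apply: lie_isom_sym; first exact: so_n1_closed.
exists (linfun lorentz_map); split=> [M N soM soN eqMN||M N soM soN].
- apply/eqP; rewrite -subr_eq0; apply/eqP/lorentz_map_inj; first by rewrite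
  memvB.
  by rewrite -fE linearB /= eqMN subrr.
- apply/eqP; rewrite eqEsubv; apply/andP; split.
    apply/subvP => _ /memv_imgP[M soM ->]; rewrite fE memvD //.
      by apply: memv_suml => k _; rewrite memvZ.
    rewrite memvZ // memv_suml // => k _; rewrite memv_suml // => l _.
    by rewrite memvZ // lie_gen_closed.
  apply: lie_gen_min.
    apply/span_subvP => _ /mapP[k _ ->].
    rewrite lorentz_map_inner -fE memv_img //; exact: inner_so_n1.
  move=> _ _ /memv_imgP[M soM ->] /memv_imgP[N soN ->].
  by rewrite !fE -lorentz_map_morph // -fE memv_img // so_n1_closed.
by rewrite !fE lorentz_map_morph.
Qed.

Lemma lie_gen_boosts_perfect : n != 1 ->
  lie_perfect (lie_gen <<[tuple a k | k < n]>>%VS).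
Proof.
move=> n_neq1; set U := <<_>>%VS.
have ag k : a k \in lie_gen U.
  by apply: (subvP (sub_lie_gen _)); rewrite memv_span // map_f ?mem_enum.
have sub_g : (commv (lie_gen U) (lie_gen U) <= lie_gen U)%VS.
  exact/commvP/lie_gen_closed.
apply/eqP; rewrite eqEsubv sub_g /=; apply: lie_gen_min.
  apply/span_subvP => _ /mapP[k _ ->].
  have [l lk] : exists l : 'I_n, l != k.
    have k_lt := ltn_ord k.
    have [k0|k_gt0] := posnP k.
      have lt1n : (1 < n)%N by rewrite k0 in k_lt; case: (n) n_neq1 k_lt =>
        [|[]].
      by exists (Ordinal lt1n); rewrite -val_eqE /= k0.
    by exists (Ordinal (leq_ltn_trans (leq0n k) k_lt)); rewrite -val_eqE /=
      eq_sym -lt0n.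
  (* A second index [l] makes each generator an iterated bracket. This fails for [n = 1], where a
     single generator commutes with itself. *)
  have -> : a k = lie_bracket (lie_bracket (a k) (a l)) (a l).
    by rewrite a_triple eqxx scale1r eq_sym (negPf lk) scale0r subr0.
  by apply: memv_comm => //; apply: lie_gen_closed.
move=> x y /(subvP sub_g) gx /(subvP sub_g) gy; exact: memv_comm.
Qed.

End Boosts.
End LorentzMatrices.

(** * Fix algebras of unipotent elements and of spinor squares *)

Section FixAlgebras.
Variables (R : realType) (V : vectType R) (dot : {dot V for @idfun R}).
Variables (n : nat) (e : n.-tuple V).
Hypothesis he : is_orthonormal_frame dot e.
Variables (Cl : falgType R) (i : 'Hom(V, Cl)).
Hypothesis hCl : is_Cl dot i.
Variable th : {lrmorphism Cl -> Cl}.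
Hypothesis thE : forall v, th (i v) = - i v.
Local Notation nu := (volume i e).

Lemma volume_conj a : ~~ odd n -> nu * a = th a * nu.
Proof.
move=> n_even.
have nu_vec v : nu * i v = - (i v * nu).
  (* For [n = 0] the truncated exponent [n.-1] yields no sign, but then every vector is zero. *)
  case: n e he n_even => [|m] f hf m_odd.
    by rewrite (frame_coord hf v) big_ord0 linear0 mulr0 mul0r oppr0.
  by rewrite (volume_comm hCl hf) -signr_odd; move: m_odd => /=/negPn->; rewrite
    scaleN1r opprK.
suff fg : (nu \*o idfun) =1 (nu \o* th) by apply: fg.
apply: (clifford_eq hCl) => [|v b] /=; first by rewrite rmorph1 mulr1 mul1r.
have -> : nu * (i v * b) = - (i v * (nu * b)) by rewrite mulrA nu_vec mulNr
  mulrA.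
by move=> ->; rewrite rmorphM /= thE !mulNr mulrA.
Qed.

Lemma volume_central a : odd n -> nu * a = a * nu.
Proof.
move=> n_odd.
suff fg : (nu \*o idfun) =1 (nu \o* idfun) by apply: fg.
apply: (clifford_eq hCl) => [|v b] /=; first by rewrite mulr1 mul1r.
have -> : nu * (i v * b) = i v * (nu * b); last by move=> ->; rewrite mulrA.
rewrite !mulrA (volume_comm hCl he) -signr_odd.
have -> : odd n.-1 = false by move: n_odd; case: (n) => //= m /negPf.
by rewrite scale1r.
Qed.

(** Passing [i Z] across a product of two vectors takes two anticommutations, whose corrections are
    multiples of these vectors. *)
Lemma bracket3_vec X Y Z : lie_bracket (lie_bracket (i X) (i Y)) (i Z) =
  4 *: (dot X Z *: i Y - dot Y Z *: i X).
Proof.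
have move_last U W : i U * i W * i Z =
    i Z * (i U * i W) + 2 *: (dot U Z *: i W - dot W Z *: i U).
  rewrite -mulrA (cliff_anticomm hCl W Z) mulrBr (mulrA (i U)) (cliff_anticomm
    hCl U Z).
  rewrite mulrBl opprB mulrA mulrN mulNr opprK -scalerAr -scalerAl mulr1 mul1r.
  by rewrite scalerBr !scalerA addrC -addrA.
rewrite {1}/lie_bracket mulrBl !move_last.
rewrite mulrBr opprD addrACA addrC addrK.
by rewrite -[- (2 *: _)]scalerN opprB -scalerDl; congr (_ *: _); ring.
Qed.

Variables (L : falgType R) (j : 'Hom(V, L)) (iprod : 'Hom(V, 'End(L))).
Hypotheses (hL : is_exterior_algebra j) (hiprod : is_interior dot j iprod).
Variable s : 'Hom(Cl, L).
Hypothesis hs : is_canonical_isom i j iprod s.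
Variable T : Cl.
Local Notation intT X := (cl_interior iprod s X T).

Lemma cl_interior_linear : linear (fun X => intT X).
Proof.
by move=> c X Y; rewrite /cl_interior linearP add_lfunE scale_lfunE linearP.
Qed.

Lemma interior_triple_so_n1 (c : R) :
    (forall X Y Z, lie_bracket (lie_bracket (intT X) (intT Y)) (intT Z) =
       c *: (dot Y Z *: intT X - dot X Z *: intT Y)) ->
    0 < c -> ~~ odd n -> th T = T -> (forall X, intT X = 0 -> X = 0) ->
  lie_isom (holonomy_algebra iprod s T) (so_n1 R n) /\
  lie_perfect (fix_algebra iprod s T).
Proof.
move=> triple c_gt0 n_even thT int_inj.
pose mixin := GRing.isSemilinear.Build _ _ _ _ _
  (GRing.semilinear_linear cl_interior_linear).
pose F : {linear V -> Cl} := HB.pack (fun X => intT X) mixin.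
(* Rescaling by [gamma] brings the constant to [1]: three factors [gamma] on the left of the triple
   relation against one on the right require [gamma * gamma * c = 1]. *)
pose gamma := (Num.sqrt c)^-1.
have gamma_neq0 : gamma != 0 by rewrite invr_eq0 sqrtr_eq0 -ltNge.
have gamma2 : gamma * gamma * c = 1.
  by rewrite -[X in _ * X](sqr_sqrtr (ltW c_gt0)) expr2 mulrACA mulVf ?mulr1 //
    sqrtr_eq0 -ltNge.
pose a k := gamma *: F (tnth e k).
have Fe k : F (tnth e k) = gamma^-1 *: a k by rewrite scalerK.
have interiors_span : interiors iprod s T = <<[tuple a k | k < n]>>%VS.
  apply/eqP; rewrite eqEsubv; apply/andP; split; apply/subvP => x.
    case/interiorsP => X ->; rewrite -[intT X]/(F X) (frame_coord he X)
      linear_sum.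
    apply: memv_suml => k _; rewrite linearZ -/F Fe 2?memvZ // memv_span //.
    by rewrite map_f ?mem_enum.
  apply/subvP/span_subvP => _ /mapP[k _ ->]; rewrite memvZ //.
  by apply/interiorsP; exists (tnth e k).
have a_triple k l m : lie_bracket (lie_bracket (a k) (a l)) (a m) =
    (l == m)%:R *: a k - (k == m)%:R *: a l.
  rewrite /a !(lie_bracketZl, lie_bracketZr) [F _]/= triple.
  have -> (x : Cl) : gamma *: (gamma *: (gamma *: (c *: x))) = gamma *: x.
    by rewrite !scalerA -(mulrAC _ c) gamma2 mul1r.
  by case: he => _ on; rewrite !on scalerBr !scalerA !(mulrC gamma).
have a_free v : boost a v = 0 -> v =1 (fun=> 0).
  move=> bv0 k.
  have : F (\sum_l v l *: tnth e l) = 0.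
    rewrite linear_sum; apply: (scalerI gamma_neq0); rewrite scaler0 -[RHS]bv0.
    rewrite scaler_sumr; apply: eq_bigr => l _.
    by rewrite linearZ /a !scalerA mulrC.
  move/int_inj/(congr1 (dot^~ (tnth e k))); rewrite dot0l dotC raddf_sum.
  rewrite (bigD1 k) //= big1 => [|l lk]; rewrite dotZr; case: he => _ ->.
    by rewrite eqxx mulr1 addr0.
  by rewrite eq_sym (negPf lk) mulr0.
have th_int X : th (intT X) = - intT X.
  rewrite (cl_interiorE hCl hL hiprod hs thE) thT linearZ rmorphB !rmorphM /=
    thE thT.
  by rewrite mulrN mulNr -opprD scalerN.
have nu_anti k : nu * a k = - (a k * nu).
  by rewrite volume_conj // linearZ /= th_int scalerN mulNr.
rewrite /holonomy_algebra /fix_algebra interiors_span.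
have perf : lie_perfect (lie_gen <<[tuple a k | k < n]>>%VS).
  by apply: lie_gen_boosts_perfect => //; apply: contraNneq n_even => ->.
split=> //; rewrite perf; apply: lie_gen_boosts_isom nu_anti a_free => //.
exact: (volume_unit hCl he).
Qed.

Lemma commutator_triple_so_n1 (c : R) (a := fun X => T * i X - i X * T) :
    (forall X Y Z, lie_bracket (lie_bracket (a X) (a Y)) (a Z) =
       c *: (dot Y Z *: a X - dot X Z *: a Y)) ->
    0 < c -> ~~ odd n -> th T = T -> (forall X, a X = 0 -> X = 0) ->
  lie_isom (holonomy_algebra iprod s T) (so_n1 R n) /\
  lie_perfect (fix_algebra iprod s T).
Proof.
move=> triple c_gt0 n_even thT a_inj.
have intE X : intT X = 2^-1 *: a X.
  by rewrite (cl_interiorE hCl hL hiprod hs thE) thT.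
(* Three factors one half on the left of the triple relation against one on the right. *)
apply: (@interior_triple_so_n1 (2^-1 * 2^-1 * c)) => // [X Y Z||X].
- rewrite !intE !(lie_bracketZl, lie_bracketZr) triple.
  rewrite !scalerA !(mulrC _ 2^-1) -![2^-1 * dot _ _ *: _]scalerA -scalerBr
    !scalerA.
  by congr (_ *: _); ring.
- by rewrite !mulr_gt0 ?invr_gt0 ?ltr0n.
by rewrite intE => /eqP; rewrite scaler_eq0 invr_eq0 pnatr_eq0 => /eqP /a_inj.
Qed.

(** Of the eight products in the expansion, the four containing [T * i X * T] or [T * i Y * T]
    vanish. *)
Lemma bracket_commutators X Y
    (c := T * i X - i X * T) (d := T * i Y - i Y * T) :
  T * i X * T = 0 -> T * i Y * T = 0 ->
  lie_bracket c d = - (T * lie_bracket (i X) (i Y) * T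
                       + (i X * (T * T) * i Y - i Y * (T * T) * i X)).
Proof.
move=> TXT TYT; rewrite /c /d /lie_bracket.
rewrite !mulrBl !mulrBr !mulrA TXT TYT !mul0r.
have TXT' a : a * T * i X * T = 0 by rewrite -!mulrA (mulrA T) TXT mulr0.
have TYT' a : a * T * i Y * T = 0 by rewrite -!mulrA (mulrA T) TYT mulr0.
rewrite TXT' TYT' !subr0 !sub0r [- (- _ - _)]opprD !opprK [RHS]opprD !opprB.
rewrite mulrBl opprB addrACA; congr (_ + _); exact: addrC.
Qed.

Lemma unipotent_fix_algebra : ~~ odd n ->
  th T = T -> nu * T = T -> T ^+ 2 = 1 + nu ->
  lie_isom (holonomy_algebra iprod s T) (so_n1 R n) /\
  lie_perfect (fix_algebra iprod s T).
Proof.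
move=> n_even thT nuT TT.
have Tnu : T * nu = T by rewrite -{1}thT -volume_conj.
have nuX X : nu * i X = - (i X * nu) by rewrite volume_conj // thE mulNr.
(* Vectors exchange [D] and [Q], while [D] acts on [T] as [2] and [Q] kills [T]. Hence
   [2 T X T = T D X T = T X Q T = 0]. *)
pose D := 1 + nu; pose Q := 1 - nu.
have DX X : D * i X = i X * Q by rewrite mulrDl mulrBr nuX mul1r mulr1.
have XD X : i X * D = Q * i X by rewrite mulrDr mulrBl nuX mul1r mulr1 opprK.
have DT : D * T = 2 *: T by rewrite mulrDl nuT mul1r scaler_nat.
have TD : T * D = 2 *: T by rewrite mulrDr Tnu mulr1 scaler_nat.
have QT : Q * T = 0 by rewrite mulrBl nuT mul1r subrr.
have TQ : T * Q = 0 by rewrite mulrBr Tnu mulr1 subrr.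
have TXT X : T * i X * T = 0.
  apply: (scalerI (_ : 2 != 0 :> R)); first by rewrite pnatr_eq0.
  by rewrite scaler0 !scalerAl -TD -(mulrA T D) DX mulrA -(mulrA _ Q) QT mulr0.
have TTD : T * T = D by rewrite -expr2.
(* Multiplying by [i X] gives [|X|^2 D = 0]. If [D = 0], then [nu = -1] both commutes and
   anticommutes with [i X], so [i X = 0]. *)
have D_inj X : D * i X = 0 -> X = 0.
  move=> DX0.
  have D_sq : dot X X *: D = 0.
    have : D * i X * i X = 0 by rewrite DX0 mul0r.
    rewrite -mulrA (cliff_sq hCl) mulrN -scalerAr mulr1.
    by move/eqP; rewrite oppr_eq0 => /eqP.
  move/eqP: D_sq; rewrite scaler_eq0 => /orP[/eqP /dot_eq0 //|/eqP D0].
  have nuN1 : nu = -1 by apply/eqP; rewrite -addr_eq0 addrC -[_ + _]/D D0.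
  have : i X = - i X by have := nuX X; rewrite nuN1 mulN1r mulrN1 opprK.
  move/eqP; rewrite -addr_eq0 -mulr2n -scaler_nat scaler_eq0 pnatr_eq0 /= =>
    /eqP iX0.
  have := cliff_sq hCl X; rewrite iX0 mul0r => /esym /eqP.
  rewrite oppr_eq0 scaler_eq0 oner_eq0 orbF => /eqP; exact: dot_eq0.
clearbody D Q.
have Dc X Y : D * lie_bracket (i X) (i Y) = lie_bracket (i X) (i Y) * D.
  by rewrite /lie_bracket mulrBr mulrBl !mulrA !DX -!mulrA !XD.
have Qc X Y : Q * lie_bracket (i X) (i Y) = lie_bracket (i X) (i Y) * Q.
  by rewrite /lie_bracket mulrBr mulrBl !mulrA -!XD -!mulrA !DX.
(* With [w = [X, Y]], the bracket of the commutators is [-(T w T + w Q)]. Its bracket with the third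
   one is [-2 (T [w, Z] - [w, Z] T)], and [bracket3_vec] contributes the remaining factor [4] of the
   constant [8]. *)
apply: (@commutator_triple_so_n1 8) => // [X Y Z|X /eqP].
  rewrite bracket_commutators // TTD -!mulrA !DX !mulrA -mulrBl -/(lie_bracket
    (i X) (i Y)).
  set w := lie_bracket (i X) (i Y).
  have wZ := bracket3_vec X Y Z; rewrite -/w in wZ.
  have wD : D * w = w * D := Dc X Y.
  have wQ : Q * w = w * Q := Qc X Y.
  clearbody w.
  have TZT b : b * T * i Z * T = 0 by rewrite -!mulrA (mulrA T) TXT mulr0.
  have E1 : T * w * T * (T * i Z - i Z * T) = 2 *: (T * w * i Z).
    rewrite mulrBr !mulrA TZT subr0 -(mulrA _ T T) TTD -(mulrA T w D) -wD mulrA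
      TD.
    by rewrite -!scalerAl.
  have E2 : w * Q * (T * i Z - i Z * T) = - (2 *: (w * i Z * T)).
    rewrite mulrBr !mulrA -(mulrA w Q T) QT mulr0 mul0r sub0r -(mulrA w Q) -XD
      mulrA.
    by rewrite -(mulrA _ D T) DT -scalerAr.
  have E3 : (T * i Z - i Z * T) * (T * w * T) = - (2 *: (i Z * w * T)).
    rewrite mulrBl !mulrA TXT !mul0r sub0r -(mulrA _ T T) TTD -(mulrA _ D w) wD
      mulrA.
    by rewrite -(mulrA _ D T) DT -scalerAr.
  have E4 : (T * i Z - i Z * T) * (w * Q) = 2 *: (T * i Z * w).
    rewrite -wQ mulrBl !mulrA -(mulrA _ T Q) TQ mulr0 mul0r subr0.
    by rewrite -(mulrA T _ Q) -DX mulrA TD -!scalerAl.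
  transitivity (- (2 *: (T * lie_bracket w (i Z) - lie_bracket w (i Z) * T))).
    rewrite [lie_bracket (- _) _]/lie_bracket mulNr mulrN opprK [X in - X +
      _]mulrDl [X in _ + X]mulrDr E1 E2 E3 E4.
    rewrite [lie_bracket w _]/lie_bracket mulrBr mulrBl !mulrA !scalerBr.
    by rewrite !opprB [X in _ + X]addrC addrACA [RHS]addrACA [X in _ = _ +
      X]addrC.
  rewrite wZ -scalerAl -scalerAr -scalerBr scalerA -scaleNr.
  rewrite mulrBr mulrBl -!scalerAl -!scalerAr.
  rewrite scaleNr -scalerN -natrM; congr (_ *: _).
  by rewrite !scalerBr !opprB addrACA [RHS]addrACA [X in X + _]addrC.
(* If [T] commutes with [i X], then [D X = T T X = T X T = 0]. *)
rewrite subr_eq0 => /eqP TX.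
by apply: D_inj; rewrite -TTD -mulrA TX mulrA TXT.
Qed.

(** * Spinor modules and squares of unit spinors *)

Section Spinors.
Variables (S : vectType R) (rho : 'Hom(Cl, 'End(S))).
Variable sdot : {dot S for @idfun R}.
Variable x : S.
Hypothesis hS : is_spinor_module dot i rho sdot.
Hypothesis x_unit : sdot x x = 1.

Let rho1 y : rho 1 y = y.
Proof. by case: hS => -> _ _ _ _; rewrite id_lfunE. Qed.

Let rhoM a b y : rho (a * b) y = rho a (rho b y).
Proof. by case: hS => _ -> _ _ _; rewrite comp_lfunE. Qed.

Let rhoMs a b : rho (a * b) = (rho a \o rho b)%VF.
Proof. by case: hS. Qed.

(** A unit vector acts orthogonally with square [-1], hence skew-symmetrically; the general case is
    linear in [X] over the frame. *)
Lemma spinor_skew X y z : sdot (rho (i X) y) z = - sdot y (rho (i X) z).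
Proof.
case: hS => _ _ _ _ orth.
have unit_skew U y' z' : dot U U = 1 ->
    sdot (rho (i U) y') z' = - sdot y' (rho (i U) z').
  move=> UU; rewrite -(orth U UU y') -rhoM (cliff_unit_sq hCl UU).
  by rewrite linearN opp_lfunE /= rho1 -scaleN1r dotZr mulN1r opprK.
rewrite (frame_coord he X) linear_sum linear_sum /= !sum_lfunE dotC !raddf_sum
  /=.
apply: eq_bigr => k _; rewrite !linearZ /= !scale_lfunE !dotZr (dotC sdot z)
  unit_skew ?mulrN //.
by rewrite (frame_unit he) // mem_tnth.
Qed.

Lemma spinor_orth X : sdot (rho (i X) x) x = 0.
Proof.
have /eqP := spinor_skew X x x; rewrite [in X in _ == X]dotC -addr_eq0 -mulr2n.
by rewrite mulrn_eq0 /= => /eqP.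
Qed.

Lemma spinor_volume_orth y z : sdot (rho nu y) (rho nu z) = sdot y z.
Proof.
case: hS => _ _ _ _ orth; rewrite volumeE.
have : {in tval e, forall v, dot v v = 1} := frame_unit he; elim: (tval e) y z
  => [|v r IH] y z unit_r.
  by rewrite big_nil !rho1.
rewrite big_cons !rhoM orth; last by apply: unit_r; rewrite mem_head.
by apply: IH => w rw; apply: unit_r; rewrite inE rw orbT.
Qed.

(** The kernel of [rho] is a proper ideal, so [graded_ideal0] applies to [a + th a] and then, once
    [th a = - a], to [a] itself. *)
Lemma spinor_graded_faithful a : rho a = 0 -> rho (th a) = 0 -> a = 0.
Proof.
have ideal v b : b \in lker rho -> i v * b \in lker rho /\ b * i v \in lker rho.
  by rewrite !memv_ker !rhoMs => /eqP->; rewrite comp_lfun0l comp_lfun0r.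
have proper : 1 \notin lker rho.
  rewrite memv_ker; apply/eqP => rho10; have := rho1 x; rewrite rho10 lfunE /=
    => x0.
  by have := x_unit; rewrite -x0 dot0l => /esym/eqP; rewrite oner_eq0.
have homog z b : z * z = 1 -> rho b = 0 -> th b = z *: b -> b = 0.
  move=> zz b0; apply: (graded_ideal0 hCl thE ideal proper (r := e)) => //.
  - exact: frame_unit he.
  - exact: frame_pairwise he.
  - by rewrite (monomials_full hCl thE (frame_unit he) (frame_pairwise he)
    (frame_span he)) memvf.
  by rewrite memv_ker b0.
move=> a0 tha0.
have /eqP : a + th a = 0.
  apply: (homog 1); first exact: mulr1.
    by rewrite linearD /= a0 tha0 addr0.
  by rewrite rmorphD /= (involutionK hCl thE) scale1r addrC.
rewrite addrC addr_eq0 => /eqP tha.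
by apply: (homog (-1)) => //; rewrite ?mulrNN ?mulr1 // scaleN1r.
Qed.

Lemma spinor_faithful a : ~~ odd n -> rho a = 0 -> a = 0.
Proof.
move=> n_even a0; apply: spinor_graded_faithful => //.
have -> : th a = nu * a * nu^-1.
  by rewrite volume_conj // mulrK // (volume_unit hCl he).
by rewrite !rhoMs a0 comp_lfun0r comp_lfun0l.
Qed.

(** For odd [n], [th] negates [nu], so [nu] acts on [th a] by [-1] from the left, whereas [rho nu]
    is the identity; hence [rho (th a) = 0]. *)
Lemma positive_spinor_faithful a :
  odd n -> rho nu = \1%VF -> nu * a = a -> rho a = 0 -> a = 0.
Proof.
move=> n_odd rho_nu nua a0; apply: spinor_graded_faithful => //.
have tha : th a = - (nu * th a).
  by rewrite -{1}nua rmorphM /= (volume_involution thE e) -signr_odd n_odd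
    scaleN1r mulNr.
have /eqP : rho (th a) = - rho (th a).
  by rewrite {1}tha linearN /= rhoMs rho_nu comp_lfun1l.
rewrite -addr_eq0 -mulr2n -scaler_nat scaler_eq0 pnatr_eq0 /= => /eqP //.
Qed.

Hypothesis T_square : acts_as_square rho sdot x T.

Lemma spinor_square_sandwich X : rho (T * i X * T) = 0.
Proof.
apply/lfunP => y; rewrite !rhoM !T_square linearZ /= [RHS]lfunE /=.
by rewrite dotZl spinor_orth mulr0 scale0r.
Qed.

Lemma spinor_square_fix_algebra : ~~ odd n -> rho nu x = x ->
  lie_perfect (fix_algebra iprod s T) /\
  lie_isom (holonomy_algebra iprod s T) (so_n1 R n).
Proof.
move=> n_even nux.
have inj a b : rho a = rho b -> a = b.
  move=> ab; apply/eqP; rewrite -subr_eq0; apply/eqP/spinor_faithful => //.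
  by rewrite linearB /= ab subrr.
have nuT : nu * T = T.
  by apply: inj; apply/lfunP => y; rewrite rhoM T_square linearZ /= nux.
have Tnu : T * nu = T.
  by apply: inj; apply/lfunP => y; rewrite rhoM !T_square -{1}nux
    spinor_volume_orth.
have thT : th T = T.
  by apply: (mulIr (volume_unit hCl he)); rewrite -volume_conj // nuT Tnu.
have TT : T * T = T.
  by apply: inj; apply/lfunP => y; rewrite rhoM !T_square dotZl x_unit mulr1.
have TXT X : T * i X * T = 0.
  by apply: spinor_faithful => //; exact: spinor_square_sandwich.
(* The left-hand side is symmetric in [X] and [Y], as its coefficient is [- sdot (i Y x) (i X x)];
   it is therefore half the value on the anticommutator. *)
have TXYT X Y : T * (i X * i Y) * T = - dot X Y *: T.
  have sym : T * (i X * i Y) * T = T * (i Y * i X) * T.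
    apply: inj; apply/lfunP => y; rewrite !rhoM !T_square !linearZ /=.
    rewrite !dotZl (spinor_skew X (rho (i Y) x)) (spinor_skew Y (rho (i X) x)).
    by rewrite (dotC sdot (rho (i Y) x)).
  apply: (scalerI (_ : 2 != 0 :> R)); first by rewrite pnatr_eq0.
  rewrite scaler_nat mulr2n {1}sym -mulrDl -mulrDr (cliff_anticomm hCl Y X)
    subrK.
  by rewrite mulrN mulNr -scalerAr -scalerAl mulr1 TT dotC scalerA mulrN
    scaleNr.
(* By the symmetry of [TXYT] the term [T [X, Y] T] drops out, leaving [-(X T Y - Y T X)]; [TXYT]
   then evaluates the bracket with the third commutator. *)
rewrite and_comm; apply: (@commutator_triple_so_n1 1) => // [X Y Z|X TX0].
  rewrite bracket_commutators // TT.
  have -> : T * lie_bracket (i X) (i Y) * T = 0.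
    by rewrite /lie_bracket mulrBr mulrBl !TXYT dotC subrr.
  have TXT' b U : b * T * i U * T = 0 by rewrite -!mulrA (mulrA T) TXT mulr0.
  have E U W : lie_bracket (i U * T * i W) (T * i Z - i Z * T) =
      dot W Z *: (i U * T) + dot Z U *: (T * i W).
    rewrite /lie_bracket mulrBr mulrBl !mulrA !TXT' !mul0r sub0r subr0.
    have -> : i U * T * i W * i Z * T = i U * (T * (i W * i Z) * T) by rewrite
      !mulrA.
    rewrite -(mulrA T (i Z)) !TXYT -scalerAr -scalerAl.
    by rewrite !scaleNr !opprK.
  rewrite add0r scale1r -scaleN1r lie_bracketZl lie_bracketDl -(scaleN1r (i Y *
    T * i X)).
  rewrite lie_bracketZl !E !scaleN1r.
  rewrite (dotC dot Z X) (dotC dot Z Y) !scalerBr !opprB opprD.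
  by rewrite [X in X + _]addrC addrACA.
(* Evaluated at [x], the commutator is [- i X x]; a second application of [i X] gives
   [|X|^2 x = 0]. *)
have : rho (T * i X - i X * T) x = 0 by rewrite TX0 linear0 lfunE.
rewrite linearB /= add_lfunE opp_lfunE !rhoM !T_square spinor_orth x_unit
  scale0r sub0r scale1r.
move/eqP; rewrite oppr_eq0 => /eqP iXx0.
have : rho (i X * i X) x = 0 by rewrite rhoM iXx0 linear0.
rewrite (cliff_sq hCl) linearN linearZ /= opp_lfunE scale_lfunE rho1 => /eqP.
rewrite oppr_eq0 scaler_eq0 => /orP[/eqP /dot_eq0 //|/eqP x0].
by have := x_unit; rewrite x0 dot0l => /esym/eqP; rewrite oner_eq0.
Qed.

Lemma spinor_square_abelian : odd n -> rho nu = \1%VF -> nu * T = T ->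
  lie_abelian (fix_algebra iprod s T) /\ holonomy_algebra iprod s T = 0%VS.
Proof.
move=> n_odd rho_nu nuT.
have TXT X : T * i X * T = 0.
  apply: positive_spinor_faithful => //; last exact: spinor_square_sandwich.
  by rewrite !mulrA nuT.
have thTnu : nu * th T = - th T.
  by rewrite -{2}nuT rmorphM /= (volume_involution thE e) -signr_odd n_odd
    scaleN1r mulNr opprK.
have thTXthT X : th T * i X * th T = 0.
  by have := congr1 th (TXT X); rewrite !rmorphM /= thE rmorph0 mulrN mulNr =>
    /eqP; rewrite oppr_eq0 => /eqP.
have self_opp (a : Cl) : a = - a -> a = 0.
  move/eqP; rewrite -addr_eq0 -mulr2n -scaler_nat scaler_eq0 pnatr_eq0 /=.
  exact: eqP.
(* The central element [nu] can be inserted next to [T], where it acts as [1], and moved to [th T],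
   where it acts as [-1]. *)
have cross_l a : th T * a * T = 0.
  apply: self_opp.
  by rewrite -{2}nuT mulrA -volume_central // !mulrA thTnu !mulNr.
have cross_r a : T * a * th T = 0.
  apply: self_opp; rewrite -mulrN -thTnu mulrA -volume_central //.
  by rewrite !mulrA nuT.
have TthT : T * th T = 0 by have := cross_r 1; rewrite mulr1.
have abel : {in interiors iprod s T &, forall a b, lie_bracket a b = 0}.
  move=> _ _ /interiorsP[X ->] /interiorsP[Y ->].
  rewrite !(cl_interiorE hCl hL hiprod hs thE) lie_bracketZl lie_bracketZr.
  have prod0 U W : (th T * i U - i U * T) * (th T * i W - i W * T) = 0.
    rewrite mulrBl !mulrBr !mulrA thTXthT mul0r -(mulrA (th T)) cross_l subr0.
    rewrite -(mulrA _ T (th T)) TthT mulr0 mul0r.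
    have -> : i U * T * i W * T = i U * (T * i W * T) by rewrite !mulrA.
    by rewrite TXT mulr0 !subr0.
  by rewrite /lie_bracket !prod0 subr0 !scaler0.
(* Since all brackets vanish, the generating subspace is already the whole fix algebra. *)
have closed : lie_closed (interiors iprod s T).
  by move=> a b Ta Tb; rewrite abel ?mem0v.
have sub := lie_gen_min (subvv _) closed.
have g_abel : lie_abelian (fix_algebra iprod s T).
  by move=> a b /(subvP sub) Ta /(subvP sub) Tb; apply: abel.
split=> //; apply/eqP; rewrite -subv0; apply/commvP => a b ga gb.
by rewrite g_abel ?mem0v.
Qed.

End Spinors.
End FixAlgebras.

Theorem theorem1p2 (R : realType) (V : vectType R) (dot : {dot V for @idfun R})
    (n : nat) (e : n.-tuple V) (he : is_orthonormal_frame dot e)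
    (Cl : falgType R) (i : 'Hom(V, Cl)) (hCl : is_Cl dot i)
    (L : falgType R) (j : 'Hom(V, L)) (hL : is_exterior_algebra j)
    (iprod : 'Hom(V, 'End(L))) (hiprod : is_interior dot j iprod)
    (s : 'Hom(Cl, L)) (hs : is_canonical_isom i j iprod s)
    (tr : 'End(Cl)) (htr : is_reversal i tr)
    (T : Cl) :
  let nu := volume i e in
  let g := fix_algebra iprod s T in
  let h := holonomy_algebra iprod s T in
  [/\ (n = 0 %[mod 4] ->
       s T \in ext_even j -> nu * T = T -> tr T = T -> T ^+ 2 = 1 + nu ->
       lie_isom h (so_n1 R n) /\ lie_perfect g),
      (n = 7 %[mod 8] ->
       forall (S : vectType R) (rho : 'Hom(Cl, 'End(S)))
         (sdot : {dot S for @idfun R}) (x : S),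
       is_spinor_module dot i rho sdot -> rho nu = \1%VF ->
       sdot x x = 1 -> nu * T = T -> acts_as_square rho sdot x T ->
       lie_abelian g /\ h = 0%VS)
    & (n = 0 %[mod 8] ->
       forall (S : vectType R) (rho : 'Hom(Cl, 'End(S)))
         (sdot : {dot S for @idfun R}) (x : S),
       is_spinor_module dot i rho sdot ->
       sdot x x = 1 -> rho nu x = x -> acts_as_square rho sdot x T ->
       lie_perfect g /\ lie_isom h (so_n1 R n))].
Proof.
have [th thE] := clifford_involution hCl.
have [thL thLE] := clifford_involution hL.
split=> [n4 sT_even nuT _ TT|n8 S rho sdot x hS rho_nu xx nuT Tx|
         n8 S rho sdot x hS xx nux Tx].
- have n_even : ~~ odd n by rewrite -(odd_mod n (d := 4)) // n4.
  apply: (unipotent_fix_algebra he hCl thE hL hiprod hs) => //.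
  exact: (involution_even hCl hL hiprod hs thE thLE).
- have n_odd : odd n by rewrite -(odd_mod n (d := 8)) // n8.
  exact: (spinor_square_abelian he hCl thE hL hiprod hs hS xx).
have n_even : ~~ odd n by rewrite -(odd_mod n (d := 8)) // n8.
exact: (spinor_square_fix_algebra he hCl thE hL hiprod hs hS xx).
Qed.
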